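(* Let $\Delta$ be a centrally symmetric finite simplicial complex with involution $\tau$, such that its geometric realisation $|\Delta|$ is simply connected. Then for every antipodal $2$-edge-colouring of the edges of the $1$-skeleton of $\Delta$ there exist a vertex $v$ of $\Delta$ and a monochromatic path in the $1$-skeleton of $\Delta$ connecting $v$ to $\tau(v)$.
   Context: A finite simplicial complex $\Delta$ is a finite collection of finite sets (simplices) closed under taking subsets; $|\Delta|$ is its geometric realisation, and its $1$-skeleton is the graph formed by its vertices and edges. $\Delta$ is centrally symmetric if it is equipped with a fixed-point-free involution $\tau$ on its vertex set which extends to an involution of the whole complex (i.e. $\tau$ maps simplices to simplices), and no simplex contains both a vertex $v$ and its antipode $\tau(v)$. A $2$-edge-colouring assigns to each edge one of the two colours red, blue. It is antipodal if for every edge $uv$ the edges $uv$ and $\tau(u)\tau(v)$ receive opposite colours. A path is monochromatic if all its edges have the same colour. Simply connected means nonempty, path-connected, with trivial fundamental group. *)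

(* Defs.v *)
From mathcomp Require Import all_boot all_order all_algebra.
From mathcomp Require Import all_classical all_reals all_analysis.
Import Order.TTheory GRing.Theory Num.Theory.
Import numFieldNormedType.Exports.

Set Implicit Arguments.
Unset Strict Implicit.
Unset Printing Implicit Defensive.

Local Open Scope classical_set_scope.
Local Open Scope ring_scope.

Section SimplyConnected.
Variables (R : realType) (T : topologicalType) (A : set T).

Definition path_in (x y : T) (f : R -> T) : Prop :=
  [/\ {within `[0, 1], continuous f}, forall t : R, 0 <= t <= 1 -> A (f t),
      f 0 = x & f 1 = y].

(* Homotopy relative to the endpoints; the first coordinate is the path
   parameter, the second one the time of the homotopy. *)
Definition path_homotopic (x y : T) (f g : R -> T) : Prop :=
  exists H : R * R -> T,
    [/\ {within `[0, 1] `*` `[0, 1], continuous H},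
        forall s t : R, 0 <= s <= 1 -> 0 <= t <= 1 -> A (H (s, t)),
        forall s : R, 0 <= s <= 1 -> H (s, 0) = f s /\ H (s, 1) = g s
      & forall t : R, 0 <= t <= 1 -> H (0, t) = x /\ H (1, t) = y].

Definition path_connected : Prop :=
  forall x y : T, A x -> A y -> exists f : R -> T, path_in x y f.

Definition trivial_pi1 (x : T) : Prop :=
  forall f : R -> T, path_in x x f -> path_homotopic x x f (cst x).

Definition simply_connected : Prop :=
  [/\ A !=set0, path_connected & forall x, A x -> trivial_pi1 x].

End SimplyConnected.

Section Complexes.
Variable V : finType.
Implicit Types (D : {set {set V}}) (tau : V -> V) (c : {set V} -> bool).

(* The points of V that are not vertices of the complex play no role. *)
Definition simplicial_complex D : Prop :=
  forall s t : {set V}, s \in D -> t \subset s -> t \in D.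

Definition vertices D : {set V} := [set v | [set v]%SET \in D]%SET.

Definition edge D : rel V :=
  [rel u v | (u != v) && ([set u; v]%SET \in D)].

Definition centrally_symmetric D tau : Prop :=
  [/\ {in vertices D, forall v, tau v \in vertices D},
      {in vertices D, forall v, tau (tau v) = v},
      {in vertices D, forall v, tau v != v},
      forall s, s \in D -> [set tau v | v in s]%SET \in D
    & forall s v, s \in D -> v \in s -> tau v \notin s].

(* Barycentric coordinates. *)
Definition realisation (R : realType) D : set {ptws V -> R} :=
  [set x | [/\ forall v, 0 <= x v, \sum_v x v = 1
             & [set v | x v != 0]%SET \in D]].

(* A 2-colouring of the edges is a c : {set V} -> bool; only its values
   c [set u; v] on edges matter. *)
Definition antipodal D tau c : Prop :=
  forall u v, edge D u v -> c [set tau u; tau v]%SET != c [set u; v]%SET.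

Definition connecting_path D (u v : V) (p : seq V) : Prop :=
  [/\ path (edge D) u p, uniq (u :: p) & last u p = v].

Definition monochromatic c (u : V) (p : seq V) : Prop :=
  exists k : bool, path [rel x y | c [set x; y]%SET == k] u p.

End Complexes.

Arguments realisation {V} R D _.

(* Main.v *)
Require Import Defs.
From mathcomp Require Import all_boot all_order all_algebra.
From mathcomp Require Import all_classical all_reals all_analysis.
From mathcomp Require Import ring lra zify.
Import Order.TTheory GRing.Theory Num.Theory.
Import numFieldNormedType.Exports.

Set Implicit Arguments.
Unset Strict Implicit.
Unset Printing Implicit Defensive.

Local Open Scope classical_set_scope.
Local Open Scope ring_scope.

(** Suppose that no vertex is joined to its antipode by a monochromatic path.
    Call two vertices equivalent when they are joined both by a path of one
    colour and by a path of the other.  The involution [tau] acts on the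
    equivalence classes, and by assumption it fixes none of them, so each
    class can be given a bit, its [side], in such a way that antipodal classes
    get different bits ([side_antipode]).  Put
    [phi u w = side u - side w] on the edges [uw] of one colour and
    [phi u w = side w - side u] on those of the other one.

    This [phi] is an integral 1-cocycle ([colour_cocycleP]): a triangle that is
    not monochromatic has two edges of the same colour, so the ends of its
    third edge are equivalent, and [side] takes the same value at both.
    Moreover [phi] is invariant under [tau], because the colour and the two
    sides are reversed together.  Modulo 2 the sign does not matter and [phi]
    is the coboundary of [side], so [phi] has an odd sum along any walk from a
    vertex [v] to [tau v].  Conceptually, the quotient of the complex by [tau]
    has fundamental group Z/2, the class of its double cover lifts to an
    integral cohomology class, and an integral class kills torsion.

    On the other hand, follow a path in the realisation from [v] to [tau v] and
    then its image under [tau].  This loop is null-homotopic, so the sum of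
    [phi] along a walk that approximates it is 0
    ([null_homotopic_cocycle_sum]).  By invariance the two halves contribute
    equally, so [phi] has sum 0 along a walk from [v] to [tau v]
    ([antipodal_cocycle_sum]): 0 would be odd.

    The passage from topology to combinatorics is a simplicial approximation.
    A point of the realisation has a barycentric coordinate at least [1/#|V|],
    and by uniform continuity, on a fine grid of the homotopy square this
    coordinate is still positive at the neighbouring grid points.  Labelling
    each grid point by a vertex with a large coordinate, the labels around a
    square of the grid lie in one simplex, and the cocycle identity there says
    that the sum along a row of the grid is the same for all rows. *)

(** * Continuity and concatenation of paths *)

Lemma continuous_ptws (X K : topologicalType) (I : Type)
    (f : X -> {ptws I -> K}) :
  (forall i, continuous (fun x => f x i)) -> continuous f.
Proof.
move=> cf x; apply/cvg_sup => i U.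
rewrite nbhsE => -[B [[C oC <-] Cfx] CU].
have : nbhs x [set y | C (f y i)].
  by apply: (cf i x); apply: open_nbhs_nbhs; split.
by apply: filterS => y Cy; apply: CU.
Qed.

Lemma within_continuous_comp (X Y Z : topologicalType) (A : set X) (B : set Y)
    (g : X -> Y) (f : Y -> Z) :
  {within B, continuous f} -> continuous g -> (forall x, A x -> B (g x)) ->
  {within A, continuous (f \o g)}.
Proof.
move=> /subspace_continuousP cf cg AB; apply/subspace_continuousP => x Ax.
apply: cvg_comp (cf _ (AB _ Ax)) => U; rewrite /within /= => nU.
have := cg x _ nU; rewrite !near_simpl /=.
by apply: filterS => y; rewrite /= => BU Ay; apply: BU; apply: AB.
Qed.

Lemma eq_within_continuous (X Y : topologicalType) (A : set X) (f g : X -> Y) :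
  (forall x, A x -> f x = g x) -> {within A, continuous f} ->
  {within A, continuous g}.
Proof.
move=> fg; apply: subspace_eq_continuous => x.
by rewrite inE => /fg.
Qed.

Definition path_concat (R : realType) (T : Type) (f g : R -> T) (t : R) : T :=
  if t <= 2^-1 then f (2 * t) else g (2 * t - 1).

Lemma path_in_concat (R : realType) (T : topologicalType) (A : set T)
    (x y z : T) (f g : R -> T) :
  path_in A x y f -> path_in A y z g -> path_in A x z (path_concat f g).
Proof.
move=> [cf Af f0 f1] [cg Ag g0 g1]; rewrite /path_concat.
have cmul : continuous (fun t : R => 2 * t) by exact: mulrl_continuous.
split.
- have -> : `[0, 1]%classic = `[0, 2^-1]%classic `|` `[2^-1, 1]%classic :> set R.
    apply/seteqP; split=> t /=; rewrite !in_itv /=.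
      by case: (lerP t 2^-1) => ? ?; [left|right]; lra.
    by case; lra.
  apply: withinU_continuous; [exact: itv_closed|exact: itv_closed| |].
  + apply: (@eq_within_continuous _ _ _ (f \o (fun t => 2 * t))) => [t /=|].
      by rewrite in_itv /= => /andP[_ t2]; rewrite t2.
    by apply: within_continuous_comp cf cmul _ => t /=; rewrite !in_itv /=; lra.
  + apply: (@eq_within_continuous _ _ _ (g \o (fun t => 2 * t - 1))) => [t /=|].
      rewrite in_itv /= => /andP[t1 t2]; case: (lerP t 2^-1) => // t3.
      have -> : t = 2^-1 by lra.
      by rewrite mulfV// subrr g0 f1.
    apply: (within_continuous_comp cg) => [t|t /=]; last by rewrite !in_itv /=; lra.
    by apply: cvgB; [exact: cmul|exact: cvg_cst].
- by move=> t t01; case: lerP => ?; [apply: Af|apply: Ag]; lra.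
- by rewrite invr_ge0 ler0n mulr0.
- rewrite ifF; last by apply: lt_geF; lra.
  by have -> : 2 * 1 - 1 = 1 :> R by lra.
Qed.

(** The Heine-Cantor theorem, in the form of a filter on the modulus of
    continuity so that finitely many functions can share one modulus. *)
Lemma compact_unif_continuous (R : realType) (M : pseudoMetricType R)
    (K : set M) (g : M -> R) (e : R) :
  compact K -> {within K, continuous g} -> 0 < e ->
  \forall d \near 0^'+, forall x y, K x -> K y -> ball x d y ->
    `|g x - g y| < e.
Proof.
move=> /compact_near_coveringP/near_covering_withinP cK /subspace_continuousP cg e0.
suff : \forall d \near 0^'+, K `<=` (fun d x => forall y, K y -> ball x d y ->
    `|g x - g y| < e) d.
  by apply: filterS => d h x y Kx; apply: h.
apply: cK => x Kx.
have /cg/cvgrPdist_lt/(_ (e / 2)) := Kx; rewrite divr_gt0// => /(_ isT).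
rewrite /within /= => /nbhs_ballP[r /= r0 rP].
exists (ball x (r / 2), [set d : R | d < r / 2]) => /=.
  split; first by apply: nbhsx_ballx; lra.
  by apply: nbhs_right_lt; lra.
move=> [y d] /= [xy dr] Ky z Kz yz.
have r20 : r = r / 2 + r / 2 by lra.
have Hy : `|g x - g y| < e / 2.
  by apply: rP => //; apply: le_ball xy; lra.
have Hz : `|g x - g z| < e / 2.
  apply: rP => //; rewrite r20; apply: ball_triangle xy _.
  by apply: le_ball yz; exact: ltW.
rewrite (_ : g y - g z = (g x - g z) - (g x - g y)); last by lra.
by apply: le_lt_trans (ler_normB _ _) _; lra.
Qed.

(** * Large barycentric coordinates *)

Definition vertex_point (R : realType) (V : finType) (v : V) : {ptws V -> R} :=
  fun w => (w == v)%:R.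

Lemma realisation_vertex_point (R : realType) (V : finType)
    (D : {set {set V}}) (v : V) :
  v \in vertices D -> realisation R D (vertex_point R v).
Proof.
rewrite inE => Dv; split=> [w||].
- by rewrite /vertex_point ler0n.
- rewrite (bigD1 v)//= /vertex_point eqxx big1 ?addr0// => w wv.
  by rewrite (negbTE wv).
- rewrite (_ : [set _ | _]%SET = [set v]%SET)//; apply/setP => w.
  by rewrite !inE /vertex_point pnatr_eq0 eqb0 negbK.
Qed.

(** The coordinates have sum 1, so they cannot all be less than [1/#|V|].  The
    bound does not depend on the point, which is what makes a uniform mesh
    possible. *)
Lemma large_coordinate (R : realType) (V : finType) (D : {set {set V}})
    (x : {ptws V -> R}) :
  realisation R D x -> exists w, #|V|%:R^-1 <= x w.
Proof.
move=> [_ sum1 _]; apply/not_existsP => small.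
have xlt w : x w < #|V|%:R^-1 by rewrite ltNge; apply/negP/small.
case: (pickP V) => [v0 _|V0]; last first.
  by move: sum1; rewrite big_pred0// => /eqP; rewrite eq_sym oner_eq0.
have V0 : (0 < #|V|)%N by apply/card_gt0P; exists v0.
have : \sum_w x w < \sum_(w : V) #|V|%:R^-1.
  rewrite (bigD1 v0)//= [ltRHS](bigD1 v0)//= ltr_leD// ler_sum// => w _.
  exact/ltW.
by rewrite sumr_const -[_ *+ _]mulr_natr mulVf ?pnatr_eq0 -?lt0n// sum1 ltxx.
Qed.

Lemma large_coordinate_choice (R : realType) (V : finType)
    (D : {set {set V}}) (v : V) :
  exists pt : {ptws V -> R} -> V,
    forall x, realisation R D x -> #|V|%:R^-1 <= x (pt x).
Proof.
exists (fun x => odflt v [pick w | #|V|%:R^-1 <= x w]).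
move=> x /large_coordinate[w xw]; case: pickP => //= /(_ w).
by rewrite xw.
Qed.

Lemma large_coordinate_vertex_point (R : realType) (V : finType) (v w : V) :
  #|V|%:R^-1 <= vertex_point R v w -> w = v.
Proof.
have V0 : (0 < #|V|)%N by apply/card_gt0P; exists v.
rewrite /vertex_point; case: eqP => // _.
by rewrite leNgt invr_gt0 ltr0n V0.
Qed.

Lemma continuous_coordinate (R : realType) (V : finType) (w : V) :
  continuous (fun x : {ptws V -> R} => x w).
Proof. exact: (@proj_continuous V (fun=> R)). Qed.

(** A vertex with a large coordinate at [F x] remains in the support of [F y]
    for all nearby [y], so that the vertices which label points near [y] span a
    simplex. *)
Lemma large_coordinate_stable (R : realType) (V : finType)
    (M : pseudoMetricType R) (K : set M)
    (F : M -> {ptws V -> R}) :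
  compact K -> {within K, continuous F} ->
  \forall d \near 0^'+, forall x y w, K x -> K y -> ball x d y ->
    #|V|%:R^-1 <= F x w -> 0 < F y w.
Proof.
move=> cK cF.
have near_w (w : V) : \forall d \near 0^'+, forall x y, K x -> K y ->
    ball x d y -> `|F x w - F y w| < #|V|%:R^-1.
  apply: (@compact_unif_continuous R M K (fun x => F x w)) => //.
    move=> x; apply: (@continuous_comp (subspace K) _ _ F (fun y => y w) x (cF x)).
    exact: continuous_coordinate.
  by rewrite invr_gt0 ltr0n; apply/card_gt0P; exists w.
near=> d => x y w Kx Ky xy Fxw.
have /(_ w x y Kx Ky xy) : forall w x y, K x -> K y ->
    ball x d y -> `|F x w - F y w| < #|V|%:R^-1.
  by near: d; apply: filter_forall.
by rewrite ltr_norml; lra.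
Unshelve. all: by end_near. Qed.

(** * Cocycles along null-homotopic loops *)

(** Discrete Stokes formula: if [phi] sums to the same value along both
    monotone ways around each unit square, then also around the whole grid. *)
Lemma grid_sum (G : zmodType) (V : Type) (phi : V -> V -> G) (N : nat)
    (b : nat -> nat -> V) :
  (forall i j, (i < N)%N -> (j < N)%N ->
    phi (b i j) (b i.+1 j) + phi (b i.+1 j) (b i.+1 j.+1) =
    phi (b i j) (b i j.+1) + phi (b i j.+1) (b i.+1 j.+1)) ->
  \sum_(i < N) phi (b i 0%N) (b i.+1 0%N) +
    \sum_(j < N) phi (b N j) (b N j.+1) =
  \sum_(j < N) phi (b 0%N j) (b 0%N j.+1) +
    \sum_(i < N) phi (b i N) (b i.+1 N).
Proof.
move=> square.
(* Turns a square identity into a difference, so that a row telescopes. *)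
have swap (x y z t : G) : x + y = z + t <-> y - z = t - x.
  split=> e; last by rewrite -[y](subrK z) e addrA [x + _]addrC subrK addrC.
  by apply/eqP; rewrite subr_eq addrAC [t + z]addrC -e addrC addKr.
apply: (iffRL (swap _ _ _ _)).
have row j : (j < N)%N ->
    phi (b N j) (b N j.+1) - phi (b 0%N j) (b 0%N j.+1) =
    \sum_(i < N) phi (b i j.+1) (b i.+1 j.+1) -
      \sum_(i < N) phi (b i j) (b i.+1 j).
  move=> jN; rewrite -sumrB -(telescope_sumr (fun i => phi (b i j) (b i j.+1)))//.
  rewrite big_mkord; apply: eq_bigr => i _.
  by apply: (iffLR (swap _ _ _ _)); exact: square.
rewrite -sumrB (eq_bigr _ (fun (j : 'I_N) _ => row j (ltn_ord j))).
rewrite -(big_mkord xpredT (fun j => \sum_(i < N) phi (b i j.+1) (b i.+1 j.+1) -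
      \sum_(i < N) phi (b i j) (b i.+1 j))).
by rewrite (telescope_sumr (fun j => \sum_(i < N) phi (b i j) (b i.+1 j))).
Qed.

(** Since [u], [v] and [w] may coincide, this includes [phi v v = 0] at
    vertices and [phi v u = - phi u v] on edges. *)
Definition cocycle (V : finType) (G : zmodType) (D : {set {set V}})
    (phi : V -> V -> G) : Prop :=
  forall s u v w, s \in D -> u \in s -> v \in s -> w \in s ->
    phi u v + phi v w = phi u w.

Lemma cocyclexx (V : finType) (G : zmodType) (D : {set {set V}})
    (phi : V -> V -> G) (v : V) :
  cocycle D phi -> v \in vertices D -> phi v v = 0.
Proof.
move=> cphi; rewrite inE => Dv.
have := cphi _ v v v Dv; rewrite set11 => /(_ isT isT isT).
by move/(congr1 (+%R^~ (- phi v v))); rewrite addrK subrr.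
Qed.

(** Only the grid points of the bottom row get a prescribed label [a i]; this
    freedom lets the label of an antipodal point be the antipodal label.  On
    the other three sides the homotopy stays at [v], and [v] is the only
    vertex with a large coordinate there, so only the bottom row contributes to
    the boundary sum. *)
Lemma null_homotopic_cocycle_sum (R : realType) (V : finType) (G : zmodType)
    (D : {set {set V}}) (phi : V -> V -> G) (v : V) (F : R -> {ptws V -> R}) :
  cocycle D phi -> v \in vertices D ->
  path_homotopic (realisation R D) (vertex_point R v) (vertex_point R v) F
    (cst (vertex_point R v)) ->
  exists N0, forall N (a : nat -> V), (N0 <= N)%N ->
    (forall i, (i <= N)%N -> #|V|%:R^-1 <= F (i%:R / N%:R) (a i)) ->
    (forall i, (i < N)%N -> exists2 s, s \in D & (a i \in s) && (a i.+1 \in s))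
    /\ \sum_(i < N) phi (a i) (a i.+1) = 0.
Proof.
move=> cphi Dv [H [cH DH Hbt Hs]].
have cK := compact_setX (@segment_compact R 0 1) (@segment_compact R 0 1).
have [d [d0 stable]] : exists d : R, 0 < d /\ forall (x y : R * R) w,
    (`[0, 1] `*` `[0, 1]) x -> (`[0, 1] `*` `[0, 1]) y ->
    ball x d y -> #|V|%:R^-1 <= H x w -> 0 < H y w.
  have := @large_coordinate_stable R V (R * R)%type _ H cK cH.
  move=> /(filterI (nbhs_right_gt (0 : R))) /filter_ex[d [d0 hd]].
  by exists d; split.
exists (Num.truncn d^-1).+1 => N a N0N aF.
have N_gt0 : (0 < N)%N by exact: leq_trans N0N.
pose q (i : nat) : R := i%:R / N%:R.
have Npos : 0 < N%:R :> R by rewrite ltr0n.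
have q01 i : (i <= N)%N -> 0 <= q i <= 1.
  by move=> iN; rewrite divr_ge0//= ler_pdivrMr// mul1r ler_nat.
have q0 : q 0%N = 0 by rewrite /q mul0r.
have qN : q N = 1 by rewrite /q divff// gt_eqF.
have mesh : N%:R^-1 < d.
  rewrite invf_plt ?posrE//; apply: lt_le_trans (truncnS_gt _) _.
  by rewrite ler_nat.
have qclose i i' : (i <= i'.+1)%N -> (i' <= i.+1)%N -> ball (q i) d (q i').
  move=> ii' i'i; rewrite /ball /= -mulrBl normrM.
  rewrite [X in _ * X]ger0_norm ?invr_ge0 ?ler0n//.
  apply: le_lt_trans mesh; rewrite ler_piMl ?invr_ge0 ?ler0n//.
  move: ii' i'i; rewrite -!(ler_nat R) -!natr1 ler_norml; lra.
have close i j i' j' w : (i <= N)%N -> (j <= N)%N -> (i' <= N)%N -> (j' <= N)%N ->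
    (i <= i'.+1)%N -> (i' <= i.+1)%N -> (j <= j'.+1)%N -> (j' <= j.+1)%N ->
    #|V|%:R^-1 <= H (q i, q j) w -> 0 < H (q i', q j') w.
  move=> iN jN i'N j'N *; apply: (stable (q i, q j)) => //=.
  - by rewrite !in_itv /= !q01.
  - by rewrite !in_itv /= !q01.
  - by split; apply: qclose.
have [pt ptP] := large_coordinate_choice R D v.
pose b i j := if j is 0%N then a i else pt (H (q i, q j)).
have Hq i j : (i <= N)%N -> (j <= N)%N -> realisation R D (H (q i, q j)).
  by move=> iN jN; apply: DH; exact: q01.
have bP i j : (i <= N)%N -> (j <= N)%N -> #|V|%:R^-1 <= H (q i, q j) (b i j).
  case: j => [|j] iN jN; last by apply: ptP; exact: Hq.
  by rewrite /b q0 (Hbt _ (q01 _ iN)).1; exact: aF.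
pose S i j : {set V} := [set w | H (q i, q j) w != 0]%SET.
have SD i j : (i <= N)%N -> (j <= N)%N -> S i j \in D.
  by move=> iN jN; case: (Hq i j iN jN).
(* The support of the image of a corner contains the labels of all its
   neighbours, so the four labels of a square lie in one simplex. *)
have bS i j i' j' : (i <= N)%N -> (j <= N)%N -> (i' <= N)%N -> (j' <= N)%N ->
    (i <= i'.+1)%N -> (i' <= i.+1)%N -> (j <= j'.+1)%N -> (j' <= j.+1)%N ->
    b i j \in S i' j'.
  by move=> iN jN *; rewrite inE gt_eqF//; apply: (close i j) => //; exact: bP.
split.
  move=> i iN; exists (S i 0%N); first by apply: SD => //; exact: ltnW.
  by apply/andP; split; [apply: (bS i 0%N)|apply: (bS i.+1 0%N)] => //; lia.
have phi0 : phi v v = 0 by apply: (cocyclexx cphi).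
have bv i j : (i == 0%N) || (i == N) || (j == N) -> (i <= N)%N -> (j <= N)%N ->
    b i j = v.
  move=> e iN jN; apply: (@large_coordinate_vertex_point R).
  suff <- : H (q i, q j) = vertex_point R v by exact: bP.
  case/orP: e => [/orP[]|] /eqP e.
  + by rewrite e q0 (Hs _ (q01 _ jN)).1.
  + by rewrite e qN (Hs _ (q01 _ jN)).2.
  + by rewrite e qN (Hbt _ (q01 _ iN)).2.
have := @grid_sum G V phi N b.
rewrite [X in _ + X = _]big1 => [|j _]; last by rewrite !bv ?eqxx ?orbT// ltnW.
rewrite [X in _ = X + _]big1 => [|j _]; last by rewrite !bv ?eqxx ?orbT// ltnW.
rewrite [X in _ = _ + X]big1 => [|i _]; last by rewrite !bv ?eqxx ?orbT// ltnW.
rewrite !addr0; apply=> i j iN jN.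
have Sij : S i j \in D by apply: SD; exact: ltnW.
rewrite (cphi _ _ _ _ Sij)//; try by apply: bS => //; lia.
by rewrite (cphi _ _ _ _ Sij)//; apply: bS => //; lia.
Qed.

(** * The antipodal map on the realisation *)

Lemma simplex_vertices (V : finType) (D : {set {set V}}) (s : {set V}) (v : V) :
  simplicial_complex D -> s \in D -> v \in s -> v \in vertices D.
Proof. by move=> scD sD vs; rewrite inE (scD _ _ sD)// finset.sub1set. Qed.

(** The case distinction is there because [tau] is arbitrary on the elements of
    [V] that are not vertices and may send them to vertices. *)
Definition antipode_point (R : realType) (V : finType) (D : {set {set V}})
    (tau : V -> V) (x : {ptws V -> R}) : {ptws V -> R} :=
  fun w => if w \in vertices D then x (tau w) else 0.

Lemma support_vertices (R : realType) (V : finType) (D : {set {set V}})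
    (x : {ptws V -> R}) (w : V) :
  simplicial_complex D -> realisation R D x -> x w != 0 -> w \in vertices D.
Proof.
by move=> scD [_ _ xD] xw; apply: (simplex_vertices scD xD); rewrite inE.
Qed.

Lemma realisation_antipode_point (R : realType) (V : finType)
    (D : {set {set V}}) (tau : V -> V) (x : {ptws V -> R}) :
  simplicial_complex D -> centrally_symmetric D tau ->
  realisation R D x -> realisation R D (antipode_point D tau x).
Proof.
move=> scD [tauV tauK _ tauD _] xD; have [x0 sum1 sD] := xD.
have supp w := @support_vertices R V D x w scD xD.
split=> [w||].
- by rewrite /antipode_point; case: ifP.
- rewrite /antipode_point -big_mkcond/= -sum1 [RHS](bigID (mem (vertices D)))/=.
  rewrite [X in _ = _ + X]big1 => [|w /negP Dw]; last first.
    by apply/eqP/negPn/negP => /supp.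
  rewrite addr0 [RHS](reindex_onto tau tau) => [|w]; last exact: tauK.
  apply: eq_bigl => w; apply/idP/andP => [Dw|[Dtw /eqP <-]]; last exact: tauV.
  by rewrite tauV// tauK.
- rewrite (_ : [set _ | _]%SET =
    [set tau w | w in [set w | x w != 0%R]%SET]%SET); first exact: tauD.
  apply/setP => w; rewrite inE /antipode_point; apply/idP/imsetP => [|[u]].
    case: ifP => [Dw xw|_]; last by rewrite eqxx.
    by exists (tau w); rewrite ?inE// tauK.
  by rewrite inE => xu ->; rewrite tauV ?tauK ?supp.
Qed.

Lemma antipode_vertex_point (R : realType) (V : finType)
    (D : {set {set V}}) (tau : V -> V) (v : V) :
  centrally_symmetric D tau -> v \in vertices D ->
  antipode_point D tau (vertex_point R v) = vertex_point R (tau v).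
Proof.
move=> [tauV tauK _ _ _] Dv; apply/funext => w.
rewrite /antipode_point /vertex_point; case: ifP => [Dw|Dw].
  by congr (nat_of_bool _)%:R; apply/eqP/eqP => [<-|->]; rewrite tauK//.
by case: eqP Dw => // ->; rewrite tauV.
Qed.

Lemma continuous_antipode_point (R : realType) (V : finType)
    (D : {set {set V}}) (tau : V -> V) :
  continuous (@antipode_point R V D tau).
Proof.
apply: (@continuous_ptws {ptws V -> R} R V (antipode_point D tau)) => w.
rewrite /antipode_point; case: (w \in vertices D).
  exact: continuous_coordinate.
exact: cst_continuous.
Qed.

Lemma path_in_comp (R : realType) (T U : topologicalType) (A : set T)
    (B : set U) (g : T -> U) (x y : T) (f : R -> T) :
  continuous g -> (forall z, A z -> B (g z)) -> path_in A x y f ->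
  path_in B (g x) (g y) (g \o f).
Proof.
move=> cg AB [cf Af <- <-]; split=> // [t|t t01]; last by apply: AB; exact: Af.
by apply: (@continuous_comp (subspace _) _ _ f g t (cf t)); exact: cg.
Qed.

(** The loop formed by a path from [v] to [tau v] and its image under the
    antipodal map has a walk consisting of two antipodal halves; the cocycle has
    the same sum on both, and twice that sum is 0 in the torsion-free group of
    integers. *)
Lemma antipodal_cocycle_sum (R : realType) (V : finType) (D : {set {set V}})
    (tau : V -> V) (phi : V -> V -> int) (v : V) :
  simplicial_complex D -> centrally_symmetric D tau ->
  simply_connected R (realisation R D) -> v \in vertices D ->
  cocycle D phi ->
  (forall s u w, s \in D -> u \in s -> w \in s ->
    phi (tau u) (tau w) = phi u w) ->
  exists (n : nat) (a : nat -> V),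
    [/\ a 0%N = v, a n = tau v & \sum_(i < n) phi (a i) (a i.+1) = 0].
Proof.
move=> scD csD [_ connD pi1] Dv cphi phi_tau.
have [tauV tauK _ _ _] := csD.
have [f ff] := connD _ _ (realisation_vertex_point R Dv)
  (realisation_vertex_point R (tauV _ Dv)).
have := path_in_comp (@continuous_antipode_point R V D tau)
  (fun x => @realisation_antipode_point R V D tau x scD csD) ff.
rewrite !antipode_vertex_point ?tauV// tauK// => ftau.
have FF := path_in_concat ff ftau.
have [N0 sum0] := null_homotopic_cocycle_sum cphi Dv
  (pi1 _ (realisation_vertex_point R Dv) _ FF).
pose M := N0.+1; have M_gt0 : 0 < M%:R :> R by rewrite ltr0n.
have [_ fD f0 f1] := ff.
have [pt ptP] := large_coordinate_choice R D v.
have pt_vertex w : w \in vertices D -> pt (vertex_point R w) = w.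
  move=> /(realisation_vertex_point R) /ptP.
  exact: large_coordinate_vertex_point.
pose b i := pt (f (i%:R / M%:R)).
have b0 : b 0%N = v by rewrite /b mul0r f0 pt_vertex.
have bM : b M = tau v by rewrite /b divff ?gt_eqF// f1 pt_vertex// tauV.
have fbD i : (i <= M)%N -> realisation R D (f (i%:R / M%:R)).
  by move=> iM; apply: fD; rewrite divr_ge0//= ler_pdivrMr// mul1r ler_nat.
have fb i : (i <= M)%N -> #|V|%:R^-1 <= f (i%:R / M%:R) (b i).
  by move=> iM; apply: ptP; exact: fbD.
have bD i : (i <= M)%N -> b i \in vertices D.
  move=> iM; apply: (support_vertices scD (fbD i iM)).
  rewrite gt_eqF//; apply: lt_le_trans (fb i iM).
  by rewrite invr_gt0 ltr0n; apply/card_gt0P; exists v.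
exists M, b; split => //.
(* Labels of the loop: antipodal labels on the second half.  At the junction
   both descriptions give [tau v]. *)
pose a i := if (i <= M)%N then b i else tau (b (i - M)%N).
have aM i : (i <= M)%N -> a (M + i)%N = tau (b i).
  rewrite /a; case: i => [|i] iM; last by rewrite ifF ?addKn//; lia.
  by rewrite addn0 leqnn bM b0.
have [|i iMM|simp] := sum0 (M + M)%N a; first by lia.
  have -> : i%:R / (M + M)%:R = i%:R / M%:R / 2 :> R.
    by rewrite addnn -muln2 natrM invfM mulrA.
  have [iM|Mi] := leqP i M.
    rewrite /a iM /path_concat ifT; last first.
      by rewrite ler_pdivrMr// mulVf// ler_pdivrMr// mul1r ler_nat.
    by rewrite [2 * _]mulrC divfK ?pnatr_eq0//; exact: fb.
  have [k /andP[k_gt0 kM] ->] : exists2 k, (0 < k <= M)%N & i = (M + k)%N.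
    by exists (i - M)%N; lia.
  rewrite aM// /path_concat ifF; last first.
    apply: lt_geF; rewrite ltr_pdivlMr// mulVf// ltr_pdivlMr// mul1r ltr_nat.
    lia.
  have -> : 2 * ((M + k)%:R / M%:R / 2) - 1 = k%:R / M%:R :> R.
    rewrite [2 * _]mulrC divfK ?pnatr_eq0// natrD mulrDl divff ?gt_eqF//.
    by rewrite addrAC subrr add0r.
  by rewrite /= /antipode_point tauV ?tauK ?bD//; exact: fb.
rewrite big_split_ord/= => sum2.
have : (\sum_(i < M) phi (b i) (b i.+1)) *+ 2 = 0.
  rewrite mulr2n -[RHS]sum2; congr (_ + _); apply: eq_bigr => i _.
    by rewrite /a ltn_ord ltnW.
  rewrite -addnS !aM//; last exact: ltnW.
  have [|s sD] := simp i; first by rewrite ltn_addr.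
  by rewrite /a ltn_ord ltnW// => /andP[si sSi]; rewrite (phi_tau s).
by move=> /eqP; rewrite mulrn_eq0 => /eqP.
Qed.

(** * The cocycle of an antipodal colouring *)

Definition colour_edge (V : finType) (D : {set {set V}}) (c : {set V} -> bool)
    (k : bool) : rel V :=
  [rel x y | edge D x y && (c [set x; y]%SET == k)].

Definition colour_class (V : finType) (D : {set {set V}})
    (c : {set V} -> bool) (v : V) : {set V} :=
  [set w | connect (colour_edge D c true) v w
         & connect (colour_edge D c false) v w]%SET.

(** Removing the loops of a monochromatic walk makes it a path. *)
Lemma connect_monochromatic (V : finType) (D : {set {set V}})
    (c : {set V} -> bool) (k : bool) (v w : V) :
  connect (colour_edge D c k) v w ->
  exists2 p : seq V, connecting_path D v w p & monochromatic c v p.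
Proof.
move=> /connectP[p0 p0P ->]; case: (shortenP p0P) => p pP p_uniq _.
exists p; first by split=> //; apply: sub_path pP => x y /andP[].
by exists k; apply: sub_path pP => x y /andP[].
Qed.

Lemma connect_colour_sym (V : finType) (D : {set {set V}})
    (c : {set V} -> bool) (k : bool) : connect_sym (colour_edge D c k).
Proof.
apply: sym_connect_sym => x y.
by rewrite /colour_edge /edge /= [x == y]eq_sym [[set x; y]%SET]finset.setUC.
Qed.

Lemma colour_class_eq (V : finType) (D : {set {set V}})
    (c : {set V} -> bool) (u w : V) :
  (forall k, connect (colour_edge D c k) u w) ->
  colour_class D c u = colour_class D c w.
Proof.
move=> uw; apply/setP => z; rewrite !inE.
by rewrite !(same_connect (@connect_colour_sym V D c _) (uw _)).
Qed.

Lemma connect_colour_antipode (V : finType) (D : {set {set V}})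
    (tau : V -> V) (c : {set V} -> bool) (k : bool) (u w : V) :
  simplicial_complex D -> centrally_symmetric D tau -> antipodal D tau c ->
  connect (colour_edge D c k) u w ->
  connect (colour_edge D c (~~ k)) (tau u) (tau w).
Proof.
move=> scD [tauV tauK _ tauD _] anti /connectP[p + ->] {w}.
elim: p u => [//|w p IH] u /= /andP[/andP[uw /eqP ck] wp].
apply: connect_trans (IH _ wp); apply: connect1.
have cuw := anti _ _ uw.
have /andP[u_w uwD] := uw.
have uD : u \in vertices D by apply: (simplex_vertices scD uwD); rewrite !inE eqxx.
have wD : w \in vertices D.
  by apply: (simplex_vertices scD uwD); rewrite !inE eqxx orbT.
apply/andP; split; last by move: cuw; rewrite ck; case: (c _) k {ck wp IH} => -[].
apply/andP; split; last by have := tauD _ uwD; rewrite imsetU1 imset_set1.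
by apply: contra_neq u_w => e; rewrite -(tauK u)// e tauK.
Qed.

(** An arbitrary choice between a class and its antipodal class: the ranks in the
    enumeration of all sets of vertices decide. *)
Definition side (V : finType) (D : {set {set V}}) (tau : V -> V)
    (c : {set V} -> bool) (v : V) : bool :=
  (enum_rank (colour_class D c v) < enum_rank (colour_class D c (tau v)))%N.

Lemma side_antipode (V : finType) (D : {set {set V}}) (tau : V -> V)
    (c : {set V} -> bool) (v : V) :
  tau (tau v) = v -> colour_class D c v != colour_class D c (tau v) ->
  side D tau c (tau v) = ~~ side D tau c v.
Proof.
move=> tauK; rewrite /side tauK -leqNgt ltn_neqAle => neq.
suff -> : (enum_rank (colour_class D c (tau v)) != enum_rank (colour_class D c v) :> nat).
  by [].
by apply: contra neq => /eqP/val_inj/enum_rank_inj ->.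
Qed.

Lemma eq_side (V : finType) (D : {set {set V}}) (tau : V -> V)
    (c : {set V} -> bool) (u w : V) :
  simplicial_complex D -> centrally_symmetric D tau -> antipodal D tau c ->
  (forall k, connect (colour_edge D c k) u w) ->
  side D tau c u = side D tau c w.
Proof.
move=> scD csD anti uw; rewrite /side (colour_class_eq uw).
rewrite (@colour_class_eq _ _ _ (tau u) (tau w))// => k.
by rewrite -[k]negbK; apply: connect_colour_antipode.
Qed.

(** In the graph whose nodes are the monochromatic components and where each
    vertex [v] gives an edge between its two components, a step along an edge of
    the complex is a path from the middle of an edge to the middle of another
    through a common node.  When the involution acts freely on that graph, this
    is an integral lift of the double cover of the quotient graph; such a lift
    exists because a graph has no cohomology in degree 2. *)
Definition colour_cocycle (V : finType) (D : {set {set V}}) (tau : V -> V)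
    (c : {set V} -> bool) (u w : V) : int :=
  (-1) ^+ c [set u; w]%SET *
    ((side D tau c u : nat)%:Z - (side D tau c w : nat)%:Z).

Lemma colour_cocycleP (V : finType) (D : {set {set V}}) (tau : V -> V)
    (c : {set V} -> bool) :
  simplicial_complex D -> centrally_symmetric D tau -> antipodal D tau c ->
  cocycle D (colour_cocycle D tau c).
Proof.
move=> scD csD anti s x y z sD xs ys zs.
have edgeP u w : u \in s -> w \in s -> u != w -> edge D u w.
  move=> us ws uw; rewrite /edge /= uw; apply: (scD _ _ sD).
  by apply/fintype.subsetP => t; rewrite !inE => /orP[] /eqP ->.
(* The third edge of a triangle whose other two edges have one colour [k]: its
   ends are joined in colour [k] through the third vertex, and directly in the
   other colour. *)
have detour u t w k : u \in s -> t \in s -> w \in s -> u != t -> t != w ->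
    u != w -> c [set u; t]%SET = k -> c [set t; w]%SET = k ->
    c [set u; w]%SET = ~~ k -> side D tau c u = side D tau c w.
  move=> us ts ws ut tw uw cut ctw cuw; apply: eq_side => // k'.
  have [->|k'k] := eqVneq k' k.
    apply: (@connect_trans _ _ t); apply: connect1; apply/andP; split.
    - exact: edgeP.
    - by rewrite cut.
    - exact: edgeP.
    - by rewrite ctw.
  apply: connect1; apply/andP; split; first exact: edgeP.
  by rewrite cuw; case: k k' k'k {cut ctw cuw} => -[].
have C u w : [set u; w]%SET = [set w; u]%SET :> {set V} by rewrite finset.setUC.
rewrite /colour_cocycle.
have [->|xy] := eqVneq x y; first by rewrite subrr mulr0 add0r.
have [->|yz] := eqVneq y z; first by rewrite subrr mulr0 addr0.
have [<-|xz] := eqVneq x z.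
  by rewrite subrr mulr0 (C y x) -mulrDr addrC subrKA subrr mulr0.
have yx : y != x by rewrite eq_sym.
have zy : z != y by rewrite eq_sym.
case cxy : (c [set x; y]%SET); case cyz : (c [set y; z]%SET);
  case cxz : (c [set x; z]%SET); rewrite /= ?expr1 ?expr0.
- by ring.
- by rewrite (detour x y z true)//; ring.
- by rewrite (detour y x z true)// 1?C//; ring.
- by rewrite (detour x z y false)// 1?(C z y)//; ring.
- by rewrite (detour x z y true)// 1?(C z y)//; ring.
- by rewrite (detour y x z false)// 1?C//; ring.
- by rewrite (detour x y z false)//; ring.
- by ring.
Qed.

(** The antipodal map reverses the colour of an edge, hence the sign of the
    cocycle, and also the sides of both ends, hence the difference. *)
Lemma colour_cocycle_antipode (V : finType) (D : {set {set V}})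
    (tau : V -> V) (c : {set V} -> bool) (s : {set V}) (u w : V) :
  simplicial_complex D -> centrally_symmetric D tau -> antipodal D tau c ->
  (forall v, v \in vertices D -> side D tau c (tau v) = ~~ side D tau c v) ->
  s \in D -> u \in s -> w \in s ->
  colour_cocycle D tau c (tau u) (tau w) = colour_cocycle D tau c u w.
Proof.
move=> scD csD anti side_tau sD us ws; rewrite /colour_cocycle.
have [->|uw] := eqVneq u w; first by rewrite !subrr !mulr0.
have /anti : edge D u w.
  rewrite /edge /= uw; apply: (scD _ _ sD).
  by apply/fintype.subsetP => t; rewrite !inE => /orP[] /eqP ->.
rewrite !side_tau; try exact: simplex_vertices sD _.
case: (c [set u; w]%SET); case: (c _) => // _; rewrite /= ?expr1 ?expr0;
  by case: (side _ _ _ u); case: (side _ _ _ w).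
Qed.

(** Modulo 2 the sign in the cocycle disappears and the sum telescopes. *)
Lemma colour_cocycle_parity (V : finType) (D : {set {set V}})
    (tau : V -> V) (c : {set V} -> bool) (a : nat -> V) (n : nat) :
  exists k : int, \sum_(i < n) colour_cocycle D tau c (a i) (a i.+1) =
    (side D tau c (a 0%N) : nat)%:Z - (side D tau c (a n) : nat)%:Z + k * 2.
Proof.
elim: n => [|n [k IH]]; first by exists 0; rewrite big_ord0 subrr mul0r addr0.
rewrite big_ord_recr/= IH /colour_cocycle.
set x := Posz _; set y := Posz _; set z := Posz _.
case: (c _); rewrite /= ?expr1 ?expr0; [exists (k + z - y)|exists k]; ring.
Qed.

Theorem theorem1p2 (R : realType) (V : finType) (D : {set {set V}})
    (tau : V -> V) (c : {set V} -> bool) :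
  simplicial_complex D ->
  centrally_symmetric D tau ->
  simply_connected R (realisation R D) ->
  antipodal D tau c ->
  exists2 v : V, v \in vertices D &
    exists2 p : seq V, connecting_path D v (tau v) p & monochromatic c v p.
Proof.
move=> scD csD simplyD anti; apply: contrapT => no_path.
have [_ tauK _ _ _] := csD.
have side_tau v : v \in vertices D ->
    side D tau c (tau v) = ~~ side D tau c v.
  move=> Dv; apply: side_antipode; first exact: tauK.
  apply/negP => /eqP e; apply: no_path; exists v => //.
  apply: (@connect_monochromatic _ _ _ true).
  have : tau v \in colour_class D c (tau v) by rewrite inE !connect0.
  by rewrite -e inE => /andP[].
have [v Dv] : exists v, v \in vertices D.
  have [[x xD] _ _] := simplyD.
  have [w xw] := large_coordinate xD; exists w.
  apply: (support_vertices scD xD); rewrite gt_eqF//; apply: lt_le_trans xw.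
  by rewrite invr_gt0 ltr0n; apply/card_gt0P; exists w.
have [n [a [a0 an sum0]]] := antipodal_cocycle_sum scD csD simplyD Dv
  (colour_cocycleP scD csD anti)
  (fun s u w => @colour_cocycle_antipode _ _ _ _ s u w scD csD anti side_tau).
have [k] := colour_cocycle_parity D tau c a n.
rewrite sum0 a0 an side_tau//.
by case: (side D tau c v) => /=; lia.
Qed.
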